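(* Let $f\in\mathcal{A}$, i.e. $f$ is analytic in $\Delta$ with $f(z)=z+a_2z^2+\cdots+a_nz^n+\cdots$, and suppose that $$\mathrm{Re}\left\{\frac{zf'(z)}{f(z)}\right\}<\frac32\quad\text{for all } z\in\Delta.$$ Then $$\mathrm{Re}\left\{\frac{z}{f(z)}\right\}>\frac12\quad\text{for all } z\in\Delta$$ and $$\left|\frac{f(z)}{z}-1\right|<1\quad\text{for all } z\in\Delta.$$ The results are sharp for the function $f_0(z)=z+z^2$: that is, $f_0\in\mathcal{A}$ satisfies the hypothesis, $\inf_{z\in\Delta}\mathrm{Re}\{z/f_0(z)\}=\frac12$ and $\sup_{z\in\Delta}|f_0(z)/z-1|=1$.
   Context: $\Delta=\{z\in\mathbb{C}:|z|<1\}$ is the open unit disc. $\mathcal{A}$ is the class of functions $f$ analytic in $\Delta$ and normalized by $f(0)=0$, $f'(0)=1$, i.e. of the form $f(z)=z+a_2z^2+\cdots+a_nz^n+\cdots$. The quotients $zf'(z)/f(z)$, $z/f(z)$ and $f(z)/z$ are understood at $z=0$ by their removable-singularity value, which is $1$. *)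

(* Defs.v *)
From Stdlib Require Import Reals.
From Coquelicot Require Import Coquelicot.
Open Scope R_scope.

Definition unit_disc (z : C) : Prop := Cmod z < 1.

Definition analytic_at (f : C -> C) (z0 : C) : Prop :=
  exists (a : nat -> C) (r : R),
    0 < r /\
    forall z : C, Cmod (z - z0)%C < r -> is_pseries a (z - z0)%C (f z).

(* The values of [f] outside the disc are irrelevant: the radius in
   [analytic_at] can be shrunk so that the expansion stays inside it. *)
Definition analytic_in_disc (f : C -> C) : Prop :=
  forall z : C, unit_disc z -> analytic_at f z.

(* [C_derive] is a total operator; it is the complex derivative wherever that
   exists, in particular wherever [f] is analytic. *)
Definition class_A (f : C -> C) : Prop :=
  analytic_in_disc f /\ f (RtoC 0) = RtoC 0 /\ C_derive f (RtoC 0) = RtoC 1.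

(* In the three quotients below the value at [0] is the removable-singularity
   value of a function of [class_A]. Division is total, with [w / 0 = 0], but a
   bound [Re (zf'_over_f f z) < c] on the whole disc excludes zeros of [f] other
   than [0]: near such a zero [z f'(z) / f(z)] has a pole, and its real part is
   unbounded above at points where [f] does not vanish. *)
Definition zf'_over_f (f : C -> C) (z : C) : C :=
  if Ceq_dec z 0 then RtoC 1 else (z * C_derive f z / f z)%C.

Definition z_over_f (f : C -> C) (z : C) : C :=
  if Ceq_dec z 0 then RtoC 1 else (z / f z)%C.

Definition f_over_z (f : C -> C) (z : C) : C :=
  if Ceq_dec z 0 then RtoC 1 else (f z / z)%C.

Definition f0 (z : C) : C := (z + z ^ 2)%C.

(* Main.v *)
(** Write [f(z) = z + z^2 g(z)], so that [f(z)/z - 1 = w(z)] with [w(z) = z g(z)].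
    If [|w| >= 1] somewhere, take such a point [z] of least modulus. Then
    [|w(z)| = 1], and the maximum principle for [g] on the disc of radius [|z|]
    (the Schwarz lemma) shows that [|g|] is maximal at [z]; differentiating at
    this boundary maximum gives [z g'(z) = k g(z)] with [k >= 0], that is,
    [f'(z) = 1 + (2 + k) w(z)]. If [w(z) <> -1], then
    [Re (z f'(z) / f(z)) = 1 + (1 + k) / 2 >= 3/2], a contradiction. If
    [w(z) = -1], then [f] has a simple zero at [z], which the hypothesis excludes.
    Finally, [Re (1 / u) > 1/2] is equivalent to [|u - 1| < 1] for [u <> 0]. *)

Require Import Defs.
From Stdlib Require Import Reals Lra Lia Psatz Classical ClassicalChoice List.
From Coquelicot Require Import Coquelicot.
Open Scope R_scope.

(** Analyticity enters only to produce, point by point, quadratic expansions with an [O(h^3)]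
    remainder; the rest is explicit estimation on them. The constant [3/2] comes from the circle
    [|w| = 1]: there [z f'/f = 1 + (1 + k) w / (1 + w)], and [Re (w / (1 + w)) = 1/2] for every such
    [w] except [-1]. The exceptional value is the delicate case: [f] vanishes at [z], total division
    makes the hypothesis at [z] itself the empty statement [0 < 3/2], and the contradiction has to
    come from nearby points. Wherever [f] does not vanish, the hypothesis says that [log |f(t z)|]
    grows more slowly than [(3/2) log t]; hence [f], once zero at [z], stays zero along the outward
    ray. That forces [f'(z) = 0], whereas [w = -1] gives [f'(z) = -(1 + k)]. *)

(** * Taylor remainders of power series *)

Lemma pow_n_Cpow (h : C) (n : nat) : pow_n (K := C_Ring) h n = (h ^ n)%C.
Proof. induction n as [|n IH]; simpl; [reflexivity | now rewrite IH]. Qed.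

Lemma filterlim_eventually_Cmod (u : nat -> C) (l : C) (eps : R) :
  filterlim u eventually (locally (T := C_NormedModule) l) -> 0 < eps ->
  exists n0, forall n, (n0 <= n)%nat -> Cmod (u n - l)%C < eps.
Proof.
  intros Hu Heps.
  destruct (Hu _ (locally_ball_norm (V := C_NormedModule) l (mkposreal _ Heps)))
    as [n0 Hn0].
  exists n0; intros n Hn.
  exact (Hn0 n Hn).
Qed.

(** Convergence at the real point [s = r / 2] bounds the terms [|a n| s^n], each being a difference
    of two partial sums. For [|h| < s / 2] the series is then dominated by a geometric one of ratio
    [q <= 1/2], whose tail after index [N] is at most [2 B q^(N+1)]. *)
Lemma is_pseries_remainder (a : nat -> C) (r : R) (F : C -> C) (N : nat) :
  0 < r ->
  (forall h : C, Cmod h < r -> is_pseries (K := C_AbsRing) (V := C_NormedModule) a h (F h)) ->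
  exists M d, 0 <= M /\ 0 < d /\
    forall h : C, Cmod h < d ->
      Cmod (F h - sum_n (G := C_AbelianMonoid) (fun k => h ^ k * a k)%C N)%C <= M * Cmod h ^ S N.
Proof.
  intros Hr HF.
  set (s := r / 2).
  assert (Hs : 0 < s) by (unfold s; lra).
  assert (Hterm : exists B, 0 <= B /\ forall n, Cmod (a n) * s ^ n <= B).
  { assert (Hm : Cmod (RtoC s) = s) by (rewrite Cmod_R, Rabs_pos_eq; lra).
    assert (Hser : is_pseries (K := C_AbsRing) (V := C_NormedModule) a (RtoC s) (F s)).
    { apply HF; rewrite Hm; unfold s; lra. }
    destruct (filterlim_bounded (K := C_AbsRing) (V := C_NormedModule) _
                (ex_intro _ _ Hser)) as [B HB].
    exists (2 * B).
    assert (HB0 : 0 <= B).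
    { eapply Rle_trans; [apply (norm_ge_0 (V := C_NormedModule)) | apply (HB 0%nat)]. }
    split; [lra |].
    intros n.
    assert (Ht : forall n, Cmod (a n) * s ^ n =
      norm (V := C_NormedModule)
           (scal (V := C_NormedModule) (pow_n (K := C_Ring) (RtoC s) n) (a n))).
    { intros m. rewrite pow_n_Cpow.
      change (Cmod (a m) * s ^ m = Cmod ((RtoC s) ^ m * a m)%C).
      rewrite Cmod_mult, Cmod_pow, Hm; ring. }
    rewrite Ht.
    destruct n as [|n].
    - specialize (HB 0%nat). rewrite sum_O in HB. eapply Rle_trans; [exact HB | lra].
    - pose proof (HB n) as H1. pose proof (HB (S n)) as H2.
      rewrite sum_Sn in H2.
      set (S0 := sum_n _ n) in *.
      set (t := scal _ _) in *.
      replace t with (minus (plus S0 t) S0).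
      2:{ unfold minus. change (S0 + t + - S0 = t)%C. ring. }
      eapply Rle_trans; [apply (norm_triangle (V := C_NormedModule)) |].
      rewrite (norm_opp (V := C_NormedModule)). lra. }
  destruct Hterm as [B [HB0 HB]].
  exists (2 * B * (/ s) ^ S N), (s / 2).
  assert (His : 0 < / s) by now apply Rinv_0_lt_compat.
  assert (HisN : 0 < (/ s) ^ S N) by now apply pow_lt.
  split; [apply Rmult_le_pos; lra |]. split; [lra |].
  intros h Hh.
  pose proof (Cmod_ge_0 h) as Hh0.
  assert (Hser : is_pseries (K := C_AbsRing) (V := C_NormedModule) a h (F h))
    by (apply HF; unfold s in *; lra).
  set (q := Cmod h / s).
  assert (Hq : 0 <= q <= 1 / 2).
  { unfold q; split.
    - apply Rmult_le_pos; lra.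
    - apply (Rmult_le_reg_r s); [lra |]. unfold Rdiv at 1. rewrite Rmult_assoc, Rinv_l; lra. }
  assert (Hcoef : forall n, Cmod (h ^ n * a n)%C <= B * q ^ n).
  { intros n. rewrite Cmod_mult, Cmod_pow.
    replace (Cmod h) with (q * s) at 1 by (unfold q; field; lra).
    rewrite Rpow_mult_distr.
    replace (q ^ n * s ^ n * Cmod (a n)) with (q ^ n * (Cmod (a n) * s ^ n)) by ring.
    rewrite (Rmult_comm B). apply Rmult_le_compat_l; [now apply pow_le |]. apply HB. }
  set (Sm := sum_n (G := C_AbelianMonoid) (fun k => h ^ k * a k)%C).
  assert (Hpart : forall m, Cmod (Sm (N + m)%nat - Sm N)%C <= B * q ^ S N * (2 - 2 * (1 / 2) ^ m)).
  { induction m as [|m IH].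
    - rewrite Nat.add_0_r. replace (Sm N - Sm N)%C with (RtoC 0) by ring.
      rewrite Cmod_0; simpl; lra.
    - rewrite Nat.add_succ_r.
      replace (Sm (S (N + m))) with (Sm (N + m)%nat + h ^ (S (N + m)) * a (S (N + m)))%C
        by (symmetry; apply (sum_Sn (G := C_AbelianMonoid))).
      set (t := (h ^ S (N + m) * a (S (N + m)))%C).
      replace (Sm (N + m)%nat + t - Sm N)%C with ((Sm (N + m)%nat - Sm N) + t)%C by ring.
      eapply Rle_trans; [apply Cmod_triangle |].
      assert (Ht : Cmod t <= B * q ^ S N * (1 / 2) ^ m).
      { eapply Rle_trans; [apply Hcoef |].
        replace (S (N + m)) with (S N + m)%nat by lia.
        rewrite pow_add, <- Rmult_assoc.
        apply Rmult_le_compat_l.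
        - apply Rmult_le_pos; [lra | apply pow_le; lra].
        - apply pow_incr; lra. }
      simpl ((1 / 2) ^ S m). lra. }
  assert (HBq : 0 <= B * q ^ S N) by (apply Rmult_le_pos; [lra | apply pow_le; lra]).
  replace (2 * B * (/ s) ^ S N * Cmod h ^ S N) with (2 * (B * q ^ S N)).
  2:{ unfold q, Rdiv. rewrite Rpow_mult_distr. ring. }
  (* The tail bound passes from partial sums to the limit: were it exceeded, a partial sum closer to
     [F h] than the excess would break [Hpart]. *)
  apply Rnot_lt_le; intros Hlt.
  set (l := Cmod (F h - Sm N)%C) in *.
  assert (Heps : 0 < l - 2 * (B * q ^ S N)) by lra.
  destruct (filterlim_eventually_Cmod _ _ _ Hser Heps) as [n0 Hn0].
  specialize (Hn0 (N + n0)%nat ltac:(lia)).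
  rewrite (sum_n_ext _ (fun k => h ^ k * a k)%C) in Hn0.
  2:{ intros n. rewrite pow_n_Cpow. reflexivity. }
  change (Cmod (Sm (N + n0)%nat - F h)%C < l - 2 * (B * q ^ S N)) in Hn0.
  specialize (Hpart n0).
  assert (Hp : 0 < (1 / 2) ^ n0) by (apply pow_lt; lra).
  assert (l <= Cmod (Sm (N + n0)%nat - F h)%C + Cmod (Sm (N + n0)%nat - Sm N)%C).
  { unfold l.
    replace (F h - Sm N)%C with (- (Sm (N + n0)%nat - F h) + (Sm (N + n0)%nat - Sm N))%C by ring.
    eapply Rle_trans; [apply Cmod_triangle |]. rewrite Cmod_opp. lra. }
  nra.
Qed.

(** * Compactness in the plane *)

(** Extreme value theorem for an upper semicontinuous [F] on a compact set. Without a maximum, each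
    point has a neighbourhood on which [F] stays below its value at some witness in [K]. Finitely
    many neighbourhoods cover [K], and the best of their witnesses would have to be beaten by
    another one. *)
Lemma bounded_closed_max (K : C -> Prop) (F : C -> R) (b : R) :
  (exists z, K z) ->
  (forall z, K z -> Cmod z <= b) ->
  (forall z, ~ K z -> exists d, 0 < d /\ forall y, Cmod (y - z)%C < d -> ~ K y) ->
  (forall z, K z -> forall eps, 0 < eps ->
     exists d, 0 < d /\ forall y, K y -> Cmod (y - z)%C < d -> F y < F z + eps) ->
  exists z, K z /\ forall y, K y -> F y <= F z.
Proof.
  intros [z0 Kz0] Kb Kcl Fusc.
  apply NNPP; intros Hno.
  (* The factor 2 pays for the change of norm: the cover is measured coordinatewise, and the modulus
     is at most [sqrt 2 < 2] times the larger coordinate. *)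
  assert (Hloc : forall z, exists p : posreal * C,
    K (snd p) /\ forall y, K y -> Cmod (y - z)%C < 2 * fst p -> F y < F (snd p)).
  { intros z. destruct (classic (K z)) as [Kz | nKz].
    - assert (Hy : exists y, K y /\ F z < F y).
      { apply NNPP; intros Hy. apply Hno. exists z; split; [easy |].
        intros y Ky. apply Rnot_lt_le; intros Hlt. apply Hy; now exists y. }
      destruct Hy as [y [Ky Hlt]].
      destruct (Fusc z Kz (F y - F z)) as [d [Hd Hu]]; [lra |].
      assert (Hd2 : 0 < d / 2) by lra.
      exists (mkposreal _ Hd2, y). simpl; split; [easy |].
      intros x Kx Hx. specialize (Hu x Kx). lra.
    - destruct (Kcl z nKz) as [d [Hd Hu]].
      assert (Hd2 : 0 < d / 2) by lra.
      exists (mkposreal _ Hd2, z0). simpl; split; [easy |].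
      intros x Kx Hx. exfalso. apply (Hu x); [lra | easy]. }
  destruct (choice _ Hloc) as [c Hc].
  set (toC := fun t : Compactness.Tn 2 R => (fst t, fst (snd t)) : C).
  (* The finite subcover comes under a double negation, which is harmless because the goal is
     [False]. *)
  apply (compactness_list 2 (- b, (- b, tt)) (b, (b, tt)) (fun t => fst (c (toC t)))).
  intros [l Hl].
  assert (Hcover : forall x, K x -> exists t, In t l /\ F x < F (snd (c (toC t)))).
  { intros x Kx.
    pose proof (Kb x Kx) as Hx.
    pose proof (Rmax_Cmod x) as Hm.
    pose proof (Rmax_l (Rabs (fst x)) (Rabs (snd x))) as Hm1.
    pose proof (Rmax_r (Rabs (fst x)) (Rabs (snd x))) as Hm2.
    destruct (Hl (fst x, (snd x, tt))) as [[t1 [t2 []]] [Hin [_ Hcl]]].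
    { simpl. split; [| split; [| easy]]; apply Rabs_le_between; lra. }
    exists (t1, (t2, tt)); split; [easy |].
    apply Hc; [easy |].
    set (d := fst (c (toC (t1, (t2, tt))))) in *.
    simpl in Hcl. unfold toC; simpl.
    destruct Hcl as [Hc1 [Hc2 _]].
    eapply Rle_lt_trans; [apply Cmod_2Rmax |].
    assert (Hs2 : sqrt 2 < 2).
    { rewrite <- (sqrt_pow2 2) at 2 by lra. apply sqrt_lt_1; lra. }
    assert (Hs0 : 0 < sqrt 2) by (apply sqrt_lt_R0; lra).
    assert (Hmx : Rmax (Rabs (fst (x - (t1, t2))%C)) (Rabs (snd (x - (t1, t2))%C)) < d).
    { apply Rmax_lub_lt; [exact Hc1 | exact Hc2]. }
    pose proof (cond_pos d). nra. }
  assert (Hmax : l <> nil -> exists t, In t l /\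
            forall t', In t' l -> F (snd (c (toC t'))) <= F (snd (c (toC t)))).
  { clear. induction l as [|t l IH]; [easy |]. intros _.
    destruct l as [|t1 l].
    - exists t; split; [now left |]. intros t' [<- | []]; lra.
    - destruct IH as [m [Hm HM]]; [easy |].
      destruct (Rle_lt_dec (F (snd (c (toC t)))) (F (snd (c (toC m))))) as [Hle | Hlt].
      + exists m; split; [now right |]. intros t' [<- | Ht']; [easy | now apply HM].
      + exists t; split; [now left |]. intros t' [<- | Ht']; [lra |].
        specialize (HM t' Ht'); lra. }
  destruct (Hcover z0 Kz0) as [t0 [Ht0 _]].
  destruct Hmax as [t [Ht HM]]; [intros ->; easy |].
  destruct (Hcover (snd (c (toC t))) (proj1 (Hc _))) as [t' [Ht' Hlt]].
  specialize (HM t' Ht'). lra.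
Qed.

(* Replaces analyticity: unlike a power series, such an expansion of [f] passes to
   [(f(z) - z) / z^2] by plain division, and order two is what the maximum
   principle needs. *)
Definition second_order (f : C -> C) (z c0 c1 c2 : C) : Prop :=
  exists M d, 0 <= M /\ 0 < d /\
    forall h : C, Cmod h < d ->
      Cmod (f (z + h) - (c0 + c1 * h + c2 * h ^ 2))%C <= M * Cmod h ^ 3.

(** * Rules for second-order expansions *)

Lemma analytic_at_second_order (f : C -> C) (z : C) :
  analytic_at f z -> exists c0 c1 c2, second_order f z c0 c1 c2.
Proof.
  intros [a [r [Hr Ha]]].
  destruct (is_pseries_remainder a r (fun h => f (z + h)%C) 2 Hr) as [M [d [HM [Hd HR]]]].
  { intros h Hh.
    replace h with (z + h - z)%C at 1 by ring.
    apply Ha. now replace (z + h - z)%C with h by ring. }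
  exists (a 0%nat), (a 1%nat), (a 2%nat), M, d.
  split; [easy |]. split; [easy |].
  intros h Hh. specialize (HR h Hh).
  rewrite 2!sum_Sn, sum_O in HR.
  match type of HR with Cmod ?u <= _ =>
    replace (f (z + h) - (a 0%nat + a 1%nat * h + a 2%nat * h ^ 2))%C with u end.
  - exact HR.
  - unfold plus; simpl; ring.
Qed.

Lemma second_order_value (f : C -> C) (z c0 c1 c2 : C) :
  second_order f z c0 c1 c2 -> c0 = f z.
Proof.
  intros [M [d [HM [Hd H]]]].
  specialize (H (RtoC 0)). rewrite Cmod_0 in H. specialize (H Hd).
  replace (z + 0)%C with z in H by ring.
  assert (H0 : Cmod (f z - (c0 + c1 * 0 + c2 * 0 ^ 2))%C = 0).
  { apply Rle_antisym; [| apply Cmod_ge_0]. eapply Rle_trans; [exact H |]. simpl; lra. }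
  apply Cmod_eq_0 in H0.
  replace (f z) with ((f z - (c0 + c1 * 0 + c2 * 0 ^ 2)) + (c0 + c1 * 0 + c2 * 0 ^ 2))%C by ring.
  rewrite H0. simpl. ring.
Qed.

Lemma second_order_first (f : C -> C) (z c0 c1 c2 : C) :
  second_order f z c0 c1 c2 ->
  exists M d, 0 <= M /\ 0 < d /\
    forall h : C, Cmod h < d -> Cmod (f (z + h) - (f z + c1 * h))%C <= M * Cmod h ^ 2.
Proof.
  intros H. rewrite <- (second_order_value _ _ _ _ _ H).
  destruct H as [M [d [HM [Hd H]]]].
  exists (M + Cmod c2), (Rmin d 1).
  pose proof (Cmod_ge_0 c2) as Hc2.
  split; [lra |]. split; [apply Rmin_glb_lt; lra |].
  intros h Hh.
  pose proof (Rmin_l d 1) as H1. pose proof (Rmin_r d 1) as H2.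
  pose proof (Cmod_ge_0 h) as Hh0.
  replace (f (z + h) - (c0 + c1 * h))%C
    with ((f (z + h) - (c0 + c1 * h + c2 * h ^ 2)) + c2 * h ^ 2)%C by ring.
  eapply Rle_trans; [apply Cmod_triangle |].
  rewrite Cmod_mult, Cmod_pow.
  specialize (H h ltac:(lra)).
  assert (M * Cmod h ^ 3 <= M * Cmod h ^ 2).
  { apply Rmult_le_compat_l; [lra |]. simpl. nra. }
  lra.
Qed.

Lemma second_order_continuous (f : C -> C) (z c0 c1 c2 : C) (eps : R) :
  second_order f z c0 c1 c2 -> 0 < eps ->
  exists d, 0 < d /\ forall y : C, Cmod (y - z)%C < d -> Cmod (f y - f z)%C < eps.
Proof.
  intros H Heps.
  destruct (second_order_first _ _ _ _ _ H) as [M [d [HM [Hd H1]]]].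
  pose proof (Cmod_ge_0 c1) as Hc1.
  set (L := M + Cmod c1 + 1).
  assert (HL : 0 < eps / L) by (apply Rdiv_lt_0_compat; unfold L; lra).
  exists (Rmin (Rmin d 1) (eps / L)).
  split; [repeat apply Rmin_glb_lt; lra |].
  intros y Hy.
  set (h := (y - z)%C) in *.
  pose proof (Rmin_l (Rmin d 1) (eps / L)). pose proof (Rmin_r (Rmin d 1) (eps / L)).
  pose proof (Rmin_l d 1). pose proof (Rmin_r d 1).
  pose proof (Cmod_ge_0 h) as Hh0.
  replace y with (z + h)%C by (unfold h; ring).
  specialize (H1 h ltac:(lra)).
  replace (f (z + h) - f z)%C with ((f (z + h) - (f z + c1 * h)) + c1 * h)%C by ring.
  eapply Rle_lt_trans; [apply Cmod_triangle |].
  rewrite Cmod_mult.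
  assert (Hlt : Cmod h * L < eps).
  { replace eps with (eps / L * L) by (field; unfold L; lra).
    apply Rmult_lt_compat_r; [unfold L; lra | lra]. }
  assert (M * Cmod h ^ 2 <= M * Cmod h).
  { apply Rmult_le_compat_l; [lra |]. simpl. nra. }
  unfold L in Hlt. nra.
Qed.

Lemma second_order_C_derive (f : C -> C) (z c0 c1 c2 : C) :
  second_order f z c0 c1 c2 -> C_derive f z = c1.
Proof.
  intros H.
  destruct (second_order_first _ _ _ _ _ H) as [M [d [HM [Hd H1]]]].
  apply is_C_lim_unique.
  refine (proj2 (filterlim_locally_ball_norm (K := C_AbsRing) (U := C_NormedModule)
            (F := locally' (T := C_UniformSpace) z) _ _) _).
  intros [eps Heps].
  assert (Hm : 0 < Rmin d (eps / (M + 1))).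
  { apply Rmin_glb_lt; [lra | apply Rdiv_lt_0_compat; lra]. }
  unfold locally', within.
  apply (filter_imp (F := locally (T := C_NormedModule) z)
          (ball_norm (V := C_NormedModule) z (mkposreal _ Hm))).
  2: exact (locally_ball_norm (V := C_NormedModule) z (mkposreal _ Hm)).
  intros x Hx Hne.
  change (Cmod (x - z)%C < Rmin d (eps / (M + 1))) in Hx.
  change (Cmod ((f x - f z) / (x - z) - c1)%C < eps).
  set (h := (x - z)%C) in *.
  assert (Hh : h <> 0).
  { intros E. apply Hne. replace x with (h + z)%C by (unfold h; ring). rewrite E.
    change (0 + z = z)%C. ring. }
  pose proof (Rmin_l d (eps / (M + 1))). pose proof (Rmin_r d (eps / (M + 1))).
  specialize (H1 h ltac:(lra)).
  replace x with (z + h)%C by (unfold h; ring).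
  replace ((f (z + h) - f z) / h - c1)%C with ((f (z + h) - (f z + c1 * h)) / h)%C
    by (field; assumption).
  rewrite Cmod_div by assumption.
  assert (Hh0 : 0 < Cmod h) by now apply Cmod_gt_0.
  apply (Rle_lt_trans _ (M * Cmod h)).
  - apply (Rmult_le_reg_r (Cmod h)); [easy |].
    unfold Rdiv. rewrite Rmult_assoc, Rinv_l by lra. lra.
  - assert (Cmod h * (M + 1) < eps).
    { replace eps with (eps / (M + 1) * (M + 1)) by (field; lra).
      apply Rmult_lt_compat_r; lra. }
    nra.
Qed.

(** The coefficients of [g] come from matching those of [y + y^2 g(y)] at [z] up to order two. The
    linear one is given explicitly because [f'(z)] is later recovered from it. *)
Lemma second_order_div_sqr (f g : C -> C) (z c0 c1 c2 : C) :
  z <> 0 -> second_order f z c0 c1 c2 ->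
  (forall y : C, y <> 0 -> f y = y + y ^ 2 * g y)%C ->
  exists b2, second_order g z (g z) ((c1 - 1 - 2 * z * g z) / z ^ 2)%C b2.
Proof.
  intros Hz Hf Hg.
  pose proof (second_order_value _ _ _ _ _ Hf) as Hc0.
  destruct Hf as [M [d [HM [Hd H]]]].
  set (b0 := g z). set (b1 := ((c1 - 1 - 2 * z * b0) / z ^ 2)%C).
  set (b2 := ((c2 - b0 - 2 * z * b1) / z ^ 2)%C).
  assert (E0 : c0 = (z + z ^ 2 * b0)%C) by (rewrite Hc0; now apply Hg).
  assert (E1 : c1 = (1 + 2 * z * b0 + z ^ 2 * b1)%C) by (unfold b1; field; assumption).
  assert (E2 : c2 = (b0 + 2 * z * b1 + z ^ 2 * b2)%C) by (unfold b2; field; assumption).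
  assert (Hz0 : 0 < Cmod z) by now apply Cmod_gt_0.
  set (L := M + Cmod (2 * z * b2 + b1)%C + Cmod b2 * Cmod z).
  assert (HL : 0 <= L).
  { unfold L. pose proof (Cmod_ge_0 (2 * z * b2 + b1)%C). pose proof (Cmod_ge_0 b2). nra. }
  exists b2, (4 * L / Cmod z ^ 2), (Rmin d (Cmod z / 2)).
  split.
  { apply Rmult_le_pos; [lra |]. left; apply Rinv_0_lt_compat, pow_lt; lra. }
  split; [apply Rmin_glb_lt; lra |].
  intros h Hh.
  pose proof (Rmin_l d (Cmod z / 2)). pose proof (Rmin_r d (Cmod z / 2)).
  pose proof (Cmod_ge_0 h) as Hh0.
  assert (Hzh : Cmod z / 2 <= Cmod (z + h)%C).
  { assert (Cmod z <= Cmod (z + h)%C + Cmod h).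
    { replace z with ((z + h) + - h)%C at 1 by ring.
      eapply Rle_trans; [apply Cmod_triangle |]. rewrite Cmod_opp; lra. }
    lra. }
  assert (Hzhn : (z + h)%C <> 0) by (apply Cmod_gt_0; lra).
  specialize (H h ltac:(lra)).
  rewrite (Hg _ Hzhn), E0, E1, E2 in H.
  set (e := (g (z + h) - (b0 + b1 * h + b2 * h ^ 2))%C).
  (* Multiplying the quadratic polynomial of [g] by [(z + h)^2] leaves a cubic term [2 z b2 + b1]
     and a quartic term [b2]; since [|h| <= |z|], [L] absorbs both. *)
  assert (He : Cmod (z + h)%C ^ 2 * Cmod e <= L * Cmod h ^ 3).
  { rewrite <- Cmod_pow, <- Cmod_mult.
    match type of H with Cmod ?u <= _ =>
      replace ((z + h) ^ 2 * e)%C with (u + - ((2 * z * b2 + b1) * h ^ 3) + - (b2 * h * h ^ 3))%C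
        by (unfold e; ring) end.
    eapply Rle_trans; [apply Cmod_triangle |]. rewrite Cmod_opp.
    eapply Rle_trans; [apply Rplus_le_compat_r, Cmod_triangle |]. rewrite Cmod_opp.
    rewrite (Cmod_mult (2 * z * b2 + b1)%C), (Cmod_mult _ (h ^ 3)%C), Cmod_mult, Cmod_pow.
    unfold L.
    assert (0 <= Cmod h ^ 3) by now apply pow_le.
    pose proof (Cmod_ge_0 b2).
    assert (Cmod b2 * Cmod h * Cmod h ^ 3 <= Cmod b2 * Cmod z * Cmod h ^ 3).
    { apply Rmult_le_compat_r; [easy |]. apply Rmult_le_compat_l; lra. }
    lra. }
  apply (Rmult_le_reg_l (Cmod z ^ 2 / 4)).
  { apply Rdiv_lt_0_compat; [apply pow_lt; lra | lra]. }
  replace (Cmod z ^ 2 / 4 * (4 * L / Cmod z ^ 2 * Cmod h ^ 3)) with (L * Cmod h ^ 3)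
    by (field; lra).
  eapply Rle_trans; [| exact He].
  apply Rmult_le_compat_r; [apply Cmod_ge_0 |].
  replace (Cmod z ^ 2 / 4) with ((Cmod z / 2) ^ 2) by field.
  apply pow_incr; lra.
Qed.

(** At the origin, division by [y^2] costs two orders, so a second-order expansion of [g] needs [f]
    up to [h^4] with remainder [h^5]. This is read off the power series itself, and the removable
    value of [g] is [a 2]. *)
Lemma analytic_at_0_quotient (f : C -> C) :
  analytic_at f 0 -> f 0 = 0 -> C_derive f 0 = 1 ->
  exists g : C -> C,
    (forall y : C, f y = y + y ^ 2 * g y)%C /\
    exists b0 b1 b2, second_order g 0 b0 b1 b2.
Proof.
  intros Hf Hf0 Hf1.
  pose proof Hf as [a [r [Hr Ha]]].
  destruct (is_pseries_remainder a r f 4 Hr) as [M [d [HM [Hd HR]]]].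
  { intros h Hh.
    replace h with (h - 0)%C at 1 by ring.
    apply Ha. now replace (h - 0)%C with h by ring. }
  assert (HR' : forall h : C, Cmod h < d ->
    Cmod (f h - (a 0%nat + a 1%nat * h + a 2%nat * h ^ 2 + a 3%nat * h ^ 3 + a 4%nat * h ^ 4))%C
      <= M * Cmod h ^ 5).
  { intros h Hh. specialize (HR h Hh).
    rewrite 4!sum_Sn, sum_O in HR.
    match type of HR with Cmod ?u <= _ =>
      match goal with |- Cmod ?v <= _ => replace v with u end end.
    - exact HR.
    - unfold plus; simpl; ring. }
  assert (Hso : second_order f 0 (a 0%nat) (a 1%nat) (a 2%nat)).
  { pose proof (Cmod_ge_0 (a 3%nat)). pose proof (Cmod_ge_0 (a 4%nat)).
    exists (M + Cmod (a 3%nat) + Cmod (a 4%nat)), (Rmin d 1).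
    split; [lra |]. split; [apply Rmin_glb_lt; lra |].
    intros h Hh. pose proof (Rmin_l d 1). pose proof (Rmin_r d 1).
    specialize (HR' h ltac:(lra)).
    pose proof (Cmod_ge_0 h) as Hh0.
    replace (0 + h)%C with h by ring.
    match type of HR' with Cmod ?u <= _ =>
      match goal with |- Cmod ?v <= _ =>
        replace v with (u + a 3%nat * h ^ 3 + a 4%nat * h ^ 4)%C by ring end end.
    eapply Rle_trans; [apply Cmod_triangle |].
    eapply Rle_trans; [apply Rplus_le_compat_r, Cmod_triangle |].
    rewrite 2!Cmod_mult, 2!Cmod_pow.
    assert (Hh3 : 0 <= Cmod h ^ 3) by now apply pow_le.
    assert (Cmod h ^ 4 <= Cmod h ^ 3) by (simpl in *; nra).
    assert (Cmod h ^ 5 <= Cmod h ^ 3).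
    { replace (Cmod h ^ 5) with (Cmod h ^ 3 * Cmod h ^ 2) by ring.
      assert (Cmod h ^ 2 <= 1) by (simpl; nra). nra. }
    nra. }
  rewrite (second_order_value _ _ _ _ _ Hso), Hf0 in HR'.
  rewrite <- (second_order_C_derive _ _ _ _ _ Hso), Hf1 in HR'.
  exists (fun y => if Ceq_dec y 0 then a 2%nat else ((f y - y) / y ^ 2)%C).
  split.
  - intros y. destruct (Ceq_dec y 0) as [-> | Hy]; [rewrite Hf0; ring | field; assumption].
  - exists (a 2%nat), (a 3%nat), (a 4%nat), M, d.
    split; [easy |]. split; [easy |].
    intros h Hh.
    replace (0 + h)%C with h by ring.
    destruct (Ceq_dec h 0) as [-> | Hy].
    + match goal with |- Cmod ?v <= _ => replace v with (RtoC 0) by ring end.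
      rewrite Cmod_0; simpl; lra.
    + specialize (HR' h Hh).
      assert (Hh0 : 0 < Cmod h) by now apply Cmod_gt_0.
      apply (Rmult_le_reg_l (Cmod h ^ 2)); [now apply pow_lt |].
      replace (Cmod h ^ 2 * (M * Cmod h ^ 3)) with (M * Cmod h ^ 5) by ring.
      rewrite <- Cmod_pow at 1. rewrite <- Cmod_mult.
      match type of HR' with Cmod ?u <= _ =>
        match goal with |- Cmod ?v <= _ => replace v with u by (field; assumption) end end.
      exact HR'.
Qed.

(** * Maximum principle and derivative at a boundary maximum *)

(** The term [eps |z|^2] makes the function strictly subharmonic: its mean over the four points
    [z + s], [z - s], [z + i s], [z - i s] exceeds the value at [z] by at least [eps s^2 - O(s^3)],
    so one of the four values is larger. No case distinction on the vanishing of [b1] or [b2]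
    arises. *)
Lemma second_order_no_max (g : C -> C) (z b0 b1 b2 : C) (eps d : R) :
  second_order g z b0 b1 b2 -> 0 < eps -> 0 < d ->
  exists h : C, Cmod h < d /\
    Cmod (g z) ^ 2 + eps * Cmod z ^ 2 < Cmod (g (z + h)%C) ^ 2 + eps * Cmod (z + h)%C ^ 2.
Proof.
  intros Hg Heps Hd.
  pose proof (second_order_value _ _ _ _ _ Hg) as Hb0.
  destruct Hg as [M [d' [HM [Hd' H]]]].
  apply NNPP; intros Hno.
  assert (Hle : forall h : C, Cmod h < d ->
    Cmod (g (z + h)%C) ^ 2 + eps * Cmod (z + h)%C ^ 2 <= Cmod b0 ^ 2 + eps * Cmod z ^ 2).
  { intros h Hh. rewrite Hb0. apply Rnot_lt_le; intros Hlt. apply Hno; now exists h. }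
  pose (P := fun h : C => (b0 + b1 * h + b2 * h ^ 2)%C).
  set (S := Cmod b0 + Cmod b1 + Cmod b2).
  pose proof (Cmod_ge_0 b0). pose proof (Cmod_ge_0 b1). pose proof (Cmod_ge_0 b2).
  assert (HSM : 0 <= S * M) by (apply Rmult_le_pos; unfold S; lra).
  (* The last entry makes [2 S M s^3 < eps s^2], where [2 S M s^3] is the cost of replacing [|g|^2]
     by [|P|^2]; [s <= 1] keeps [|P| <= S]. *)
  set (s := Rmin (Rmin d d') (Rmin 1 (eps / (2 * S * M + 1))) / 2).
  assert (Hs : 0 < s /\ s < d /\ s < d' /\ s <= 1 /\ 2 * S * M * s < eps).
  { assert (He : 0 < eps / (2 * S * M + 1)) by (apply Rdiv_lt_0_compat; nra).
    pose proof (Rmin_l (Rmin d d') (Rmin 1 (eps / (2 * S * M + 1)))).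
    pose proof (Rmin_r (Rmin d d') (Rmin 1 (eps / (2 * S * M + 1)))).
    pose proof (Rmin_l d d'). pose proof (Rmin_r d d').
    pose proof (Rmin_l 1 (eps / (2 * S * M + 1))). pose proof (Rmin_r 1 (eps / (2 * S * M + 1))).
    assert (Hs0 : 0 < s).
    { unfold s. apply Rdiv_lt_0_compat; [| lra]. repeat apply Rmin_glb_lt; lra. }
    assert (s < eps / (2 * S * M + 1)) by (unfold s in *; lra).
    assert (s * (2 * S * M + 1) < eps).
    { replace eps with (eps / (2 * S * M + 1) * (2 * S * M + 1)) by (field; nra).
      apply Rmult_lt_compat_r; nra. }
    unfold s in *. repeat split; lra. }
  destruct Hs as [Hs0 [Hsd [Hsd' [Hs1 Hse]]]].
  assert (Hlow : forall h : C, Cmod h = s ->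
    Cmod (P h) ^ 2 - 2 * S * M * s ^ 3 + eps * Cmod (z + h)%C ^ 2
      <= Cmod b0 ^ 2 + eps * Cmod z ^ 2).
  { intros h Hh.
    assert (HP : Cmod (P h) <= S).
    { unfold P, S.
      eapply Rle_trans; [apply Cmod_triangle |].
      eapply Rle_trans; [apply Rplus_le_compat_r, Cmod_triangle |].
      rewrite 2!Cmod_mult, Cmod_pow, Hh.
      assert (s ^ 2 <= 1) by (simpl; nra). nra. }
    assert (Hge : Cmod (P h) <= Cmod (g (z + h)%C) + M * s ^ 3).
    { specialize (H h ltac:(lra)). rewrite Hh in H.
      replace (P h) with (g (z + h) + - (g (z + h) - P h))%C by ring.
      eapply Rle_trans; [apply Cmod_triangle |]. rewrite Cmod_opp.
      fold (P h) in H. lra. }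
    specialize (Hle h ltac:(lra)).
    pose proof (Cmod_ge_0 (P h)). pose proof (Cmod_ge_0 (g (z + h)%C)).
    set (e := M * s ^ 3) in *.
    assert (He : 0 <= e) by (apply Rmult_le_pos; [lra | apply pow_le; lra]).
    replace (2 * S * M * s ^ 3) with (2 * S * e) by (unfold e; ring).
    assert (Cmod (P h) ^ 2 - 2 * S * e <= Cmod (g (z + h)%C) ^ 2).
    { apply (Rle_trans _ (Cmod (P h) ^ 2 - 2 * Cmod (P h) * e)); [nra |].
      destruct (Rle_lt_dec (Cmod (P h)) e); nra. }
    lra. }
  assert (E1 : Cmod (s, 0) = s).
  { unfold Cmod; simpl. replace (s * (s * 1) + 0 * (0 * 1)) with (s ^ 2) by ring.
    apply sqrt_pow2; lra. }
  assert (E2 : Cmod (0, s) = s).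
  { unfold Cmod; simpl. replace (0 * (0 * 1) + s * (s * 1)) with (s ^ 2) by ring.
    apply sqrt_pow2; lra. }
  pose proof (Hlow (s, 0) E1) as L1.
  pose proof (Hlow (0, s) E2) as L2.
  pose proof (Hlow (- (s, 0))%C ltac:(now rewrite Cmod_opp)) as L3.
  pose proof (Hlow (- (0, s))%C ltac:(now rewrite Cmod_opp)) as L4.
  (* Averaging over the four points kills every mixed term of |P h|^2. *)
  assert (Hsum : Cmod (P (s, 0)) ^ 2 + Cmod (P (0, s)) ^ 2
      + Cmod (P (- (s, 0))%C) ^ 2 + Cmod (P (- (0, s))%C) ^ 2
    = 4 * (Cmod b0 ^ 2 + Cmod b1 ^ 2 * s ^ 2 + Cmod b2 ^ 2 * s ^ 4)).
  { rewrite !Cmod2_alt. unfold P. destruct b0, b1, b2. simpl. ring. }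
  assert (Hsum' : Cmod (z + (s, 0))%C ^ 2 + Cmod (z + (0, s))%C ^ 2
      + Cmod (z + - (s, 0))%C ^ 2 + Cmod (z + - (0, s))%C ^ 2
    = 4 * (Cmod z ^ 2 + s ^ 2)).
  { rewrite !Cmod2_alt. destruct z. simpl. ring. }
  assert (0 <= Cmod b1 ^ 2 * s ^ 2) by (apply Rmult_le_pos; apply pow_le; lra).
  assert (0 <= Cmod b2 ^ 2 * s ^ 4) by (apply Rmult_le_pos; apply pow_le; lra).
  assert (Hs2 : 0 < s ^ 2) by now apply pow_lt.
  assert (2 * S * M * s ^ 3 < eps * s ^ 2).
  { replace (2 * S * M * s ^ 3) with (2 * S * M * s * s ^ 2) by ring.
    now apply Rmult_lt_compat_r. }
  assert (Hsum'' := f_equal (Rmult eps) Hsum').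
  lra.
Qed.

(** The function [|g|^2 + eps |z|^2] attains its maximum on the closed disc, and not at an interior
    point. On the circle it is at most [B^2 + eps r^2], which [eps] is chosen to keep below
    [|g z2|^2]. *)
Lemma maximum_modulus (g : C -> C) (r B : R) :
  0 <= B ->
  (forall z : C, Cmod z <= r -> exists b0 b1 b2, second_order g z b0 b1 b2) ->
  (forall z : C, Cmod z = r -> Cmod (g z) <= B) ->
  forall z : C, Cmod z <= r -> Cmod (g z) <= B.
Proof.
  intros HB Hg Hbd z2 Hz2.
  apply Rnot_lt_le; intros Hlt.
  pose proof (Cmod_ge_0 z2).
  assert (Hr2 : 0 <= r ^ 2) by (apply pow_le; lra).
  assert (HB2 : B ^ 2 < Cmod (g z2) ^ 2) by (simpl; nra).
  set (eps := (Cmod (g z2) ^ 2 - B ^ 2) / (r ^ 2 + 1)).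
  assert (Heps : 0 < eps) by (apply Rdiv_lt_0_compat; lra).
  assert (Heps2 : eps * r ^ 2 < Cmod (g z2) ^ 2 - B ^ 2).
  { assert (eps * (r ^ 2 + 1) = Cmod (g z2) ^ 2 - B ^ 2) by (unfold eps; field; lra). lra. }
  pose (F := fun z : C => Cmod (g z) ^ 2 + eps * Cmod z ^ 2).
  destruct (bounded_closed_max (fun z => Cmod z <= r) F r) as [z1 [Hz1 Hmax]].
  - now exists z2.
  - easy.
  - intros z Hz. exists (Cmod z - r). split; [lra |].
    intros y Hy Hyr.
    assert (Cmod z <= Cmod y + Cmod (y - z)%C).
    { replace z with (y + - (y - z))%C at 1 by ring.
      eapply Rle_trans; [apply Cmod_triangle |]. rewrite Cmod_opp; lra. }
    lra.
  - intros z Hz e He.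
    destruct (Hg z Hz) as [b0 [b1 [b2 Hso]]].
    pose proof (Cmod_ge_0 (g z)) as Hgz.
    set (L := 2 * Cmod (g z) + 1 + eps * (2 * r + 1)).
    assert (HL : 1 <= L) by (unfold L; nra).
    set (t := Rmin 1 (e / L)).
    assert (Ht : 0 < t) by (apply Rmin_glb_lt; [lra | apply Rdiv_lt_0_compat; lra]).
    assert (Ht1 : t <= 1) by apply Rmin_l.
    assert (HtL : t * L <= e).
    { replace e with (e / L * L) by (field; lra).
      apply Rmult_le_compat_r; [lra | apply Rmin_r]. }
    destruct (second_order_continuous _ _ _ _ _ t Hso Ht) as [d [Hd Hc]].
    exists (Rmin d t). split; [now apply Rmin_glb_lt |].
    intros y Hy Hyz.
    pose proof (Rmin_l d t). pose proof (Rmin_r d t).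
    specialize (Hc y ltac:(lra)).
    assert (Hgy : Cmod (g y) < Cmod (g z) + t).
    { replace (g y) with (g z + (g y - g z))%C by ring.
      eapply Rle_lt_trans; [apply Cmod_triangle |]. lra. }
    assert (Hy1 : Cmod y < Cmod z + t).
    { replace y with (z + (y - z))%C at 1 by ring.
      eapply Rle_lt_trans; [apply Cmod_triangle |]. lra. }
    pose proof (Cmod_ge_0 (g y)). pose proof (Cmod_ge_0 y). pose proof (Cmod_ge_0 z).
    unfold F.
    assert (Cmod (g y) ^ 2 < Cmod (g z) ^ 2 + t * (2 * Cmod (g z) + 1)) by (simpl; nra).
    assert (Cmod y ^ 2 < Cmod z ^ 2 + t * (2 * r + 1)) by (simpl; nra).
    assert (eps * Cmod y ^ 2 < eps * (Cmod z ^ 2 + t * (2 * r + 1)))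
      by now apply Rmult_lt_compat_l.
    unfold L in HtL. nra.
  - destruct (Rle_lt_or_eq_dec _ _ Hz1) as [Hin | Hon].
    + destruct (Hg z1 Hz1) as [b0 [b1 [b2 Hso]]].
      destruct (second_order_no_max _ _ _ _ _ eps (r - Cmod z1) Hso Heps) as [h [Hh Hlt1]];
        [lra |].
      assert (Hzh : Cmod (z1 + h)%C <= r).
      { eapply Rle_trans; [apply Cmod_triangle |]. lra. }
      specialize (Hmax _ Hzh). unfold F in Hmax. lra.
    + specialize (Hmax z2 Hz2). specialize (Hbd z1 Hon).
      unfold F in Hmax. rewrite Hon in Hmax.
      pose proof (Cmod_ge_0 (g z1)).
      assert (Cmod (g z1) ^ 2 <= B ^ 2) by (apply pow_incr; lra).
      assert (0 <= eps * Cmod z2 ^ 2) by (apply Rmult_le_pos; [lra | apply pow_le; lra]).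
      lra.
Qed.

(* Jack's lemma without its lower bound on the multiplier. *)
Lemma boundary_max_derivative (g : C -> C) (z b1 b2 : C) :
  z <> 0 -> g z <> 0 -> second_order g z (g z) b1 b2 ->
  (forall y : C, Cmod y <= Cmod z -> Cmod (g y) <= Cmod (g z)) ->
  exists k : R, 0 <= k /\ (z * b1 = k * g z)%C.
Proof.
  intros Hz Hgz Hg Hmax.
  set (q := (z * b1 / g z)%C).
  assert (Hq : (z * b1 = q * g z)%C) by (unfold q; field; assumption).
  assert (Hz0 : 0 < Cmod z) by now apply Cmod_gt_0.
  assert (Hg0 : 0 < Cmod (g z)) by now apply Cmod_gt_0.
  (* For [Re e < 0], the step from [z] to [z (1 + s e)] points into the disc, so [|g|] cannot grow
     to first order, and its relative growth rate is [Re (q e)]. Being nonpositive on the whole open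
     left half-plane forces [q] to be real and nonnegative. *)
  assert (Hdir : forall e : C, Re e < 0 -> Re (q * e)%C <= 0).
  { intros e He.
    destruct (second_order_first _ _ _ _ _ Hg) as [M [d [HM [Hd H]]]].
    apply Rnot_lt_le; intros Hlt.
    assert (He0 : 0 < Cmod e).
    { apply Cmod_gt_0. intros E. rewrite E in He. simpl in He. lra. }
    set (m := Cmod z * Cmod e).
    assert (Hm : 0 < m) by now apply Rmult_lt_0_compat.
    set (L := M * m ^ 2 / Cmod (g z)).
    assert (HL : 0 <= L).
    { apply Rmult_le_pos; [apply Rmult_le_pos; [lra | apply pow_le; lra] |].
      left; now apply Rinv_0_lt_compat. }
    (* The four demands on [s]: it is positive, [h] stays in the range of the expansion,
       [|1 + s e| <= 1], and the quadratic remainder loses against [s Re (q e)]. *)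
    assert (Hs : exists s, 0 < s /\ s * m < d /\ s * Cmod e ^ 2 <= - 2 * Re e /\ s * L < Re (q * e)%C).
    { assert (He2 : 0 < Cmod e ^ 2) by now apply pow_lt.
      exists (Rmin (d / m) (Rmin (- 2 * Re e / Cmod e ^ 2) (Re (q * e)%C / (L + 1))) / 2).
      set (A := d / m). set (A' := - 2 * Re e / Cmod e ^ 2). set (A'' := Re (q * e)%C / (L + 1)).
      assert (EA : A * m = d) by (unfold A; field; lra).
      assert (EA' : A' * Cmod e ^ 2 = - 2 * Re e) by (unfold A'; field; lra).
      assert (EA'' : A'' * (L + 1) = Re (q * e)%C) by (unfold A''; field; lra).
      assert (0 < A) by (apply Rdiv_lt_0_compat; lra).
      assert (0 < A') by (apply Rdiv_lt_0_compat; lra).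
      assert (0 < A'') by (apply Rdiv_lt_0_compat; lra).
      set (s := Rmin A (Rmin A' A'')).
      assert (0 < s) by (repeat apply Rmin_glb_lt; lra).
      assert (s <= A) by apply Rmin_l.
      assert (s <= A') by (eapply Rle_trans; [apply Rmin_r | apply Rmin_l]).
      assert (s <= A'') by (eapply Rle_trans; [apply Rmin_r | apply Rmin_r]).
      repeat split; nra. }
    destruct Hs as [s [Hs0 [Hsd [Hse Hsq]]]].
    set (h := (s * (z * e))%C).
    assert (Hh : Cmod h = s * m).
    { unfold h, m. rewrite 2!Cmod_mult, Cmod_R, Rabs_pos_eq; lra. }
    specialize (H h ltac:(lra)).
    assert (Hin : Cmod (z + h)%C <= Cmod z).
    { replace (z + h)%C with (z * (1 + s * e))%C by (unfold h; ring).
      rewrite Cmod_mult.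
      assert (Cmod (1 + s * e)%C <= 1).
      { apply Rsqr_incr_0_var; [| lra].
        rewrite !Rsqr_pow2, Cmod2_alt. rewrite Cmod2_alt in Hse.
        destruct e as [e1 e2]; simpl in *. nra. }
      nra. }
    specialize (Hmax _ Hin).
    (* Dividing by [g z]: |1 + s q e| <= 1 + O(s^2), and the left side is at least
       1 + s Re (q e). *)
    assert (Hq1 : Cmod (g z) * Cmod (1 + s * (q * e))%C <= Cmod (g z) + M * (s * m) ^ 2).
    { rewrite <- Cmod_mult.
      replace (g z * (1 + s * (q * e)))%C with (g z + b1 * h)%C.
      2:{ unfold h. replace (b1 * (s * (z * e)))%C with ((z * b1) * s * e)%C by ring.
          rewrite Hq. ring. }
      rewrite <- Hh.
      replace (g z + b1 * h)%C with (g (z + h) + - (g (z + h) - (g z + b1 * h)))%C by ring.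
      eapply Rle_trans; [apply Cmod_triangle |]. rewrite Cmod_opp. lra. }
    assert (Hre : 1 + s * Re (q * e)%C <= Cmod (1 + s * (q * e))%C).
    { eapply Rle_trans; [| apply re_le_Cmod].
      eapply Rle_trans; [| apply Rle_abs].
      right. destruct q, e. simpl. ring. }
    assert (HLe : M * (s * m) ^ 2 = Cmod (g z) * (s * (s * L))) by (unfold L; field; lra).
    rewrite HLe in Hq1.
    assert (Cmod (1 + s * (q * e))%C <= 1 + s * (s * L)).
    { apply (Rmult_le_reg_l (Cmod (g z))); lra. }
    assert (s * (s * L) < s * Re (q * e)%C) by now apply Rmult_lt_compat_l.
    lra. }
  clearbody q. destruct q as [k k'].
  assert (Hk : 0 <= k).
  { specialize (Hdir (RtoC (-1))). simpl in Hdir. lra. }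
  assert (Hk' : k' = 0).
  { assert (Hd : forall x y, x < 0 -> k * x - k' * y <= 0).
    { intros x y Hx. exact (Hdir (x, y) Hx). }
    apply NNPP; intros Hn.
    (* The second coordinate is chosen so that [k x - k' y = -k + (k + 1) = 1], which is
       positive. *)
    specialize (Hd (-1) (- (k + 1) / k') ltac:(lra)).
    replace (k' * (- (k + 1) / k')) with (- (k + 1)) in Hd by (field; assumption).
    lra. }
  exists k. split; [easy |]. rewrite Hq, Hk'. reflexivity.
Qed.

(** * Exclusion of simple zeros along rays *)

Lemma is_derive_of_quadratic_bound (phi : R -> R) (t L M d : R) :
  0 <= M -> 0 < d ->
  (forall k, Rabs k < d -> Rabs (phi (t + k) - (phi t + L * k)) <= M * k ^ 2) ->
  is_derive phi t L.
Proof.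
  intros HM Hd H.
  apply is_derive_Reals. intros eps Heps.
  assert (Hm : 0 < Rmin d (eps / (M + 1))).
  { apply Rmin_glb_lt; [lra | apply Rdiv_lt_0_compat; lra]. }
  exists (mkposreal _ Hm). intros k Hk Hkd. simpl in Hkd.
  pose proof (Rmin_l d (eps / (M + 1))). pose proof (Rmin_r d (eps / (M + 1))).
  specialize (H k ltac:(lra)).
  assert (Hk0 : 0 < Rabs k) by now apply Rabs_pos_lt.
  replace ((phi (t + k) - phi t) / k - L) with ((phi (t + k) - (phi t + L * k)) / k)
    by (field; assumption).
  rewrite Rabs_div by assumption.
  rewrite <- pow2_abs in H.
  apply (Rle_lt_trans _ (M * Rabs k)).
  - apply (Rmult_le_reg_r (Rabs k)); [easy |].
    unfold Rdiv. rewrite Rmult_assoc, Rinv_l by lra. lra.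
  - assert (Rabs k * (M + 1) < eps).
    { replace eps with (eps / (M + 1) * (M + 1)) by (field; lra).
      apply Rmult_lt_compat_r; lra. }
    nra.
Qed.

Lemma im_le_Cmod (c : C) : Rabs (Im c) <= Cmod c.
Proof. eapply Rle_trans; [apply Rmax_r | apply (Rmax_Cmod c)]. Qed.

Lemma second_order_ray (f : C -> C) (z c0 c1 c2 : C) (t : R) :
  second_order f (t * z)%C c0 c1 c2 ->
  is_derive (fun t : R => Re (f (t * z)%C)) t (Re (c1 * z)%C) /\
  is_derive (fun t : R => Im (f (t * z)%C)) t (Im (c1 * z)%C).
Proof.
  intros Hf.
  destruct (second_order_first _ _ _ _ _ Hf) as [M [d [HM [Hd H]]]].
  pose proof (Cmod_ge_0 z) as Hz.
  assert (Hk : forall k, Rabs k < d / (Cmod z + 1) ->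
    Cmod (f ((t + k)%R * z) - (f (t * z) + c1 * z * k))%C <= M * Cmod z ^ 2 * k ^ 2).
  { intros k Hk.
    assert (Hh : Cmod (k * z)%C = Rabs k * Cmod z) by now rewrite Cmod_mult, Cmod_R.
    pose proof (Rabs_pos k).
    assert (Hlt : Cmod (k * z)%C < d).
    { rewrite Hh.
      assert (Rabs k * (Cmod z + 1) < d).
      { replace d with (d / (Cmod z + 1) * (Cmod z + 1)) by (field; lra).
        apply Rmult_lt_compat_r; lra. }
      lra. }
    specialize (H _ Hlt). rewrite Hh in H.
    replace ((t + k)%R * z)%C with (t * z + k * z)%C by (rewrite RtoC_plus; ring).
    replace (c1 * z * k)%C with (c1 * (k * z))%C by ring.
    rewrite <- (pow2_abs k).
    replace (M * Cmod z ^ 2 * Rabs k ^ 2) with (M * (Rabs k * Cmod z) ^ 2) by ring.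
    exact H. }
  assert (Hd' : 0 < d / (Cmod z + 1)) by (apply Rdiv_lt_0_compat; lra).
  assert (HM' : 0 <= M * Cmod z ^ 2) by (apply Rmult_le_pos; [lra | apply pow_le; lra]).
  split; apply (is_derive_of_quadratic_bound _ _ _ _ _ HM' Hd'); intros k Hkd;
    specialize (Hk k Hkd); (eapply Rle_trans; [| exact Hk]).
  - eapply Rle_trans; [| apply re_le_Cmod]. right; f_equal.
    destruct (f ((t + k)%R * z)%C), (f (t * z)%C), (c1 * z)%C; simpl; ring.
  - eapply Rle_trans; [| apply im_le_Cmod]. right; f_equal.
    destruct (f ((t + k)%R * z)%C), (f (t * z)%C), (c1 * z)%C; simpl; ring.
Qed.

Lemma Re_Cdiv_lt (a w : C) (c : R) :
  w <> 0 -> Re (a / w)%C < c -> Re a * Re w + Im a * Im w < c * (Re w ^ 2 + Im w ^ 2).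
Proof.
  intros Hw H.
  assert (Hp : 0 < Re w ^ 2 + Im w ^ 2).
  { rewrite <- Cmod2_alt. apply pow_lt. now apply Cmod_gt_0. }
  apply (Rmult_lt_compat_r _ _ _ Hp) in H.
  replace (Re (a / w)%C * (Re w ^ 2 + Im w ^ 2)) with (Re a * Re w + Im a * Im w) in H; [easy |].
  destruct a, w. simpl in *. field. lra.
Qed.

(* Along a ray, |f(t z)|^2 / t^3 has derivative of the sign of
   Re (z f'(z) / f(z)) - 3/2, so it cannot leave the value 0. *)
Lemma zero_derivative_at_zero (f : C -> C) (z : C) :
  (forall y : C, unit_disc y -> exists c0 c1 c2, second_order f y c0 c1 c2) ->
  (forall y : C, unit_disc y -> Re (zf'_over_f f y) < 3 / 2) ->
  z <> 0 -> unit_disc z -> f z = 0 -> C_derive f z = 0.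
Proof.
  intros Hf Hre Hz Hzd Hfz.
  assert (Hz0 : 0 < Cmod z) by now apply Cmod_gt_0.
  unfold unit_disc in Hzd.
  (* The ray runs outwards, from [z] at [t = 1] to the unit circle at [t = 1 / |z|]. *)
  assert (Hdisc : forall t, 1 <= t < / Cmod z -> unit_disc (t * z)%C /\ (t * z)%C <> 0).
  { intros t Ht.
    assert (Hm : Cmod (t * z)%C = t * Cmod z)
      by (rewrite Cmod_mult, Cmod_R, Rabs_pos_eq; lra).
    split.
    - unfold unit_disc. rewrite Hm.
      replace 1 with (/ Cmod z * Cmod z) by (field; lra).
      apply Rmult_lt_compat_r; lra.
    - apply Cmod_gt_0. rewrite Hm. nra. }
  pose (U := fun t : R => Re (f (t * z)%C)).
  pose (V := fun t : R => Im (f (t * z)%C)).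
  pose (N := fun t : R => (U t ^ 2 + V t ^ 2) / t ^ 3).
  assert (HN : forall t, 1 <= t < / Cmod z -> exists l, is_derive N t l /\ l <= 0).
  { intros t Ht.
    destruct (Hdisc t Ht) as [Hd Hne].
    destruct (Hf _ Hd) as [c0 [c1 [c2 Hso]]].
    destruct (second_order_ray _ _ _ _ _ _ Hso) as [HU HV].
    exists ((2 * (Re (c1 * z)%C * U t + Im (c1 * z)%C * V t) * t - 3 * (U t ^ 2 + V t ^ 2)) / t ^ 4).
    split.
    - unfold N. auto_derive.
      + split; [eexists; exact HU |]. split; [eexists; exact HV |].
        split; [| easy]. change (t ^ 3 <> 0). apply pow_nonzero; lra.
      + change (fun x => U x) with U. change (fun x => V x) with V.
        rewrite (is_derive_unique U _ _ HU), (is_derive_unique V _ _ HV). field. lra.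
    - assert (Ht4 : 0 < / t ^ 4) by (apply Rinv_0_lt_compat, pow_lt; lra).
      assert (Hnum : 2 * (Re (c1 * z)%C * U t + Im (c1 * z)%C * V t) * t
                       - 3 * (U t ^ 2 + V t ^ 2) <= 0).
      { destruct (Ceq_dec (f (t * z)%C) 0) as [E | E].
        - unfold U, V. rewrite E. simpl. lra.
        - specialize (Hre _ Hd). unfold zf'_over_f in Hre.
          destruct (Ceq_dec (t * z)%C 0) as [E' | _]; [easy |].
          rewrite (second_order_C_derive _ _ _ _ _ Hso) in Hre.
          apply (Re_Cdiv_lt _ _ _ E) in Hre.
          fold (U t) (V t) in Hre.
          replace (Re (t * z * c1)%C) with (t * Re (c1 * z)%C) in Hre
            by (destruct z, c1; simpl; ring).
          replace (Im (t * z * c1)%C) with (t * Im (c1 * z)%C) in Hre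
            by (destruct z, c1; simpl; ring).
          lra. }
      unfold Rdiv. nra. }
  (* By the mean value theorem [N] is at most [N 1 = 0]; its numerator is a sum of squares, so both
     squares vanish. *)
  assert (Hzero : forall t, 1 <= t < / Cmod z -> U t = 0 /\ V t = 0).
  { assert (E1 : U 1 = 0 /\ V 1 = 0).
    { unfold U, V. replace (1 * z)%C with z by ring. now rewrite Hfz. }
    intros t Ht. destruct (Rle_lt_or_eq_dec 1 t) as [Hlt | <-]; [lra | | easy].
    assert (HN' : forall x, 1 <= x <= t -> derivable_pt_lim N x (Derive N x)).
    { intros x Hx. destruct (HN x ltac:(lra)) as [l [Hl _]].
      apply is_derive_Reals. rewrite (is_derive_unique _ _ _ Hl). exact Hl. }
    destruct (MVT_cor2 N (Derive N) 1 t Hlt HN') as [x [Hx Hx1]].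
    destruct (HN x ltac:(lra)) as [l [Hl Hl0]].
    rewrite (is_derive_unique _ _ _ Hl) in Hx.
    assert (N 1 = 0) by (unfold N; rewrite (proj1 E1), (proj2 E1); field).
    assert (HNt : N t <= 0) by nra.
    assert (Ht3 : 0 < t ^ 3) by (apply pow_lt; lra).
    assert (Hs : U t ^ 2 + V t ^ 2 <= 0).
    { replace (U t ^ 2 + V t ^ 2) with (N t * t ^ 3) by (unfold N; field; lra). nra. }
    pose proof (pow2_ge_0 (U t)). pose proof (pow2_ge_0 (V t)).
    split; apply Rsqr_0_uniq; rewrite Rsqr_pow2; lra. }
  destruct (Hf z Hzd) as [c0 [c1 [c2 Hso]]].
  rewrite (second_order_C_derive _ _ _ _ _ Hso).
  destruct (second_order_first _ _ _ _ _ Hso) as [M [d [HM [Hd H]]]].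
  apply Cmod_eq_0, Rle_antisym; [| apply Cmod_ge_0].
  apply Rnot_lt_le; intros Hc.
  assert (HT : 1 < / Cmod z) by (rewrite <- Rinv_1 at 1; apply Rinv_lt_contravar; lra).
  (* If [c1] were nonzero, [f(z + k z) = 0] would give [|c1| <= M k |z|], which the last entry of
     the minimum prevents. *)
  set (k := Rmin (Rmin d (/ Cmod z - 1)) (Cmod c1 / (M + 1)) / 2).
  assert (Hk : 0 < k /\ k < d /\ k < / Cmod z - 1 /\ k * (M + 1) < Cmod c1).
  { set (A := Cmod c1 / (M + 1)) in *.
    assert (0 < A) by (apply Rdiv_lt_0_compat; lra).
    assert (HA : A * (M + 1) = Cmod c1) by (unfold A; field; lra).
    pose proof (Rmin_l (Rmin d (/ Cmod z - 1)) A). pose proof (Rmin_r (Rmin d (/ Cmod z - 1)) A).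
    pose proof (Rmin_l d (/ Cmod z - 1)). pose proof (Rmin_r d (/ Cmod z - 1)).
    assert (0 < k).
    { unfold k. apply Rdiv_lt_0_compat; [| lra]. repeat apply Rmin_glb_lt; lra. }
    unfold k in *. repeat split; nra. }
  destruct Hk as [Hk0 [Hkd [Hkz Hkc]]].
  assert (Hh : Cmod (k * z)%C = k * Cmod z) by (rewrite Cmod_mult, Cmod_R, Rabs_pos_eq; lra).
  specialize (H (k * z)%C ltac:(rewrite Hh; nra)).
  destruct (Hzero (1 + k) ltac:(lra)) as [HU HV].
  assert (Hfk : f (z + k * z)%C = 0).
  { replace (z + k * z)%C with ((1 + k)%R * z)%C by (rewrite RtoC_plus; ring).
    unfold U, V, Re, Im in HU, HV. rewrite (surjective_pairing (f _)), HU, HV. reflexivity. }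
  rewrite Hfk, Hfz in H.
  replace (0 - (0 + c1 * (k * z)))%C with (- (c1 * (k * z)))%C in H by ring.
  rewrite Cmod_opp, Cmod_mult, Hh in H.
  assert (Hkz0 : 0 < k * Cmod z) by now apply Rmult_lt_0_compat.
  assert (Cmod c1 <= M * (k * Cmod z)).
  { apply (Rmult_le_reg_r (k * Cmod z)); [easy |]. simpl in H. lra. }
  assert (k * Cmod z <= k) by nra.
  nra.
Qed.

(** * The bound on [f(z)/z - 1] *)

Lemma second_order_mul_id_continuous (g : C -> C) (z b0 b1 b2 : C) (eps : R) :
  second_order g z b0 b1 b2 -> 0 < eps ->
  exists d, 0 < d /\ forall y : C, Cmod (y - z)%C < d -> Cmod (y * g y - z * g z)%C < eps.
Proof.
  intros H Heps.
  pose proof (Cmod_ge_0 z) as Hz. pose proof (Cmod_ge_0 (g z)) as Hg.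
  set (A := eps / (2 * (Cmod z + 1))). set (B := eps / (2 * (Cmod (g z) + 1))).
  assert (HA : 0 < A) by (apply Rdiv_lt_0_compat; lra).
  assert (HB : 0 < B) by (apply Rdiv_lt_0_compat; lra).
  assert (EA : (Cmod z + 1) * A = eps / 2) by (unfold A; field; lra).
  assert (EB : (Cmod (g z) + 1) * B = eps / 2) by (unfold B; field; lra).
  destruct (second_order_continuous _ _ _ _ _ A H HA) as [d [Hd Hc]].
  exists (Rmin d (Rmin 1 B)). split; [repeat apply Rmin_glb_lt; lra |].
  intros y Hy.
  pose proof (Rmin_l d (Rmin 1 B)). pose proof (Rmin_r d (Rmin 1 B)).
  pose proof (Rmin_l 1 B). pose proof (Rmin_r 1 B).
  specialize (Hc y ltac:(lra)).
  assert (Hy1 : Cmod y <= Cmod z + 1).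
  { replace y with (z + (y - z))%C at 1 by ring.
    eapply Rle_trans; [apply Cmod_triangle |]. lra. }
  replace (y * g y - z * g z)%C with (y * (g y - g z) + (y - z) * g z)%C by ring.
  eapply Rle_lt_trans; [apply Cmod_triangle |]. rewrite 2!Cmod_mult.
  pose proof (Cmod_ge_0 (g y - g z)%C). pose proof (Cmod_ge_0 (y - z)%C).
  pose proof (Cmod_ge_0 y). nra.
Qed.

Lemma f_over_z_bound (f : C -> C) :
  class_A f ->
  (forall z : C, unit_disc z -> Re (zf'_over_f f z) < 3 / 2) ->
  forall z : C, unit_disc z -> Cmod (f_over_z f z - 1)%C < 1.
Proof.
  intros [Han [Hf0 Hf1]] Hre zs Hzs.
  assert (Hd0 : unit_disc 0) by (unfold unit_disc; rewrite Cmod_0; lra).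
  destruct (analytic_at_0_quotient f (Han _ Hd0) Hf0 Hf1) as [g [Hg Hg0]].
  assert (Hfso : forall y, unit_disc y -> exists c0 c1 c2, second_order f y c0 c1 c2)
    by (intros y Hy; now apply analytic_at_second_order, Han).
  assert (Hgso : forall y, unit_disc y -> exists b0 b1 b2, second_order g y b0 b1 b2).
  { intros y Hy. destruct (Ceq_dec y 0) as [-> | Hy0]; [easy |].
    destruct (Hfso y Hy) as [c0 [c1 [c2 Hso]]].
    destruct (second_order_div_sqr _ g _ _ _ _ Hy0 Hso) as [b2 Hb]; [intros; apply Hg |].
    eexists; eexists; eexists; exact Hb. }
  apply Rnot_le_lt; intros Hge.
  assert (Hzs1 : 1 <= Cmod (zs * g zs)%C).
  { unfold f_over_z in Hge. destruct (Ceq_dec zs 0) as [E | E].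
    - replace (1 - 1)%C with (RtoC 0) in Hge by ring. rewrite Cmod_0 in Hge. lra.
    - rewrite Hg in Hge.
      replace ((zs + zs ^ 2 * g zs) / zs - 1)%C with (zs * g zs)%C in Hge by (field; assumption).
      exact Hge. }
  unfold unit_disc in *.
  (* Maximizing [-|z|] yields the point of least modulus; restricting to [|z| <= |zs|] makes the set
     compact inside the open disc. *)
  destruct (bounded_closed_max (fun z => Cmod z <= Cmod zs /\ 1 <= Cmod (z * g z)%C)
              (fun z => - Cmod z) 1) as [z [[Hzle Hz1] Hmin]].
  - exists zs; split; [lra | easy].
  - intros y [Hy _]; lra.
  - intros y Hy.
    destruct (Rlt_le_dec (Cmod zs) (Cmod y)) as [Hlt | Hle].
    + exists (Cmod y - Cmod zs). split; [lra |].
      intros x Hx [Hxz _].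
      assert (Cmod y <= Cmod x + Cmod (x - y)%C).
      { replace y with (x + - (x - y))%C at 1 by ring.
        eapply Rle_trans; [apply Cmod_triangle |]. rewrite Cmod_opp; lra. }
      lra.
    + assert (Hy1 : Cmod (y * g y)%C < 1) by (apply Rnot_le_lt; intros H; now apply Hy).
      destruct (Hgso y ltac:(lra)) as [b0 [b1 [b2 Hso]]].
      destruct (second_order_mul_id_continuous _ _ _ _ _ (1 - Cmod (y * g y)%C) Hso ltac:(lra))
        as [d [Hd Hc]].
      exists d. split; [easy |]. intros x Hx [_ Hx1].
      specialize (Hc x Hx).
      assert (Cmod (x * g x)%C <= Cmod (y * g y)%C + Cmod (x * g x - y * g y)%C).
      { replace (x * g x)%C with (y * g y + (x * g x - y * g y))%C at 1 by ring.
        apply Cmod_triangle. }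
      lra.
  - intros y _ eps Heps. exists eps. split; [easy |].
    intros x _ Hx.
    assert (Cmod y <= Cmod x + Cmod (x - y)%C).
    { replace y with (x + - (x - y))%C at 1 by ring.
      eapply Rle_trans; [apply Cmod_triangle |]. rewrite Cmod_opp; lra. }
    lra.
  - assert (Hz : z <> 0).
    { intros E. rewrite E, Cmult_0_l, Cmod_0 in Hz1. lra. }
    assert (Hr : 0 < Cmod z) by now apply Cmod_gt_0.
    assert (Hin : forall y, Cmod y < Cmod z -> Cmod (y * g y)%C < 1).
    { intros y Hy. apply Rnot_le_lt; intros H.
      assert (Hyle : Cmod y <= Cmod zs) by lra.
      specialize (Hmin y (conj Hyle H)). cbv beta in Hmin. lra. }
    (* A circle point is the limit of the points [(1 - s) y], where [|w| < 1] by minimality, so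
       continuity of [w] gives the weak bound. *)
    assert (Hcirc : forall y, Cmod y = Cmod z -> Cmod (y * g y)%C <= 1).
    { intros y Hy. apply Rnot_lt_le; intros Hlt.
      destruct (Hgso y ltac:(lra)) as [b0 [b1 [b2 Hso]]].
      destruct (second_order_mul_id_continuous _ _ _ _ _ (Cmod (y * g y)%C - 1) Hso ltac:(lra))
        as [d [Hd Hc]].
      set (s := Rmin d 1 / 2).
      pose proof (Rmin_l d 1). pose proof (Rmin_r d 1).
      assert (Hs : 0 < Rmin d 1) by (apply Rmin_glb_lt; lra).
      set (x := ((1 - s)%R * y)%C).
      assert (Hx : Cmod x < Cmod z).
      { unfold x, s. rewrite Cmod_mult, Cmod_R, Rabs_pos_eq by lra. rewrite Hy. nra. }
      specialize (Hin x Hx).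
      assert (Hxy : Cmod (x - y)%C < d).
      { replace (x - y)%C with (- (s * y))%C by (unfold x; rewrite RtoC_minus; ring).
        rewrite Cmod_opp, Cmod_mult, Cmod_R, Rabs_pos_eq by (unfold s; lra).
        unfold s. nra. }
      specialize (Hc x Hxy).
      assert (Cmod (y * g y)%C <= Cmod (x * g x)%C + Cmod (x * g x - y * g y)%C).
      { replace (y * g y)%C with (x * g x + - (x * g x - y * g y))%C at 1 by ring.
        eapply Rle_trans; [apply Cmod_triangle |]. rewrite Cmod_opp; lra. }
      lra. }
    assert (Hw1 : Cmod (z * g z)%C = 1) by (apply Rle_antisym; [now apply Hcirc | easy]).
    assert (Hgz : Cmod (g z) = / Cmod z).
    { rewrite Cmod_mult in Hw1. apply (Rmult_eq_reg_l (Cmod z)); [| lra].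
      rewrite Hw1. field. lra. }
    (* On the circle [|w| <= 1] reads [|g| <= 1 / |z|], which is the value attained at [z]. *)
    assert (Hmax : forall y, Cmod y <= Cmod z -> Cmod (g y) <= Cmod (g z)).
    { apply maximum_modulus; [apply Cmod_ge_0 | intros y Hy; apply Hgso; lra |].
      intros y Hy. specialize (Hcirc y Hy). rewrite Cmod_mult, Hy in Hcirc. rewrite Hgz.
      apply (Rmult_le_reg_l (Cmod z)); [easy |]. rewrite Rinv_r; lra. }
    destruct (Hfso z ltac:(lra)) as [c0 [c1 [c2 Hso]]].
    destruct (second_order_div_sqr _ g _ _ _ _ Hz Hso) as [b2 Hb]; [intros; apply Hg |].
    assert (Hgz0 : g z <> 0) by (apply Cmod_gt_0; rewrite Hgz; now apply Rinv_0_lt_compat).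
    destruct (boundary_max_derivative _ _ _ _ Hz Hgz0 Hb Hmax) as [k [Hk Hjack]].
    set (w := (z * g z)%C) in *.
    assert (Hc1 : c1 = (1 + (2 + k) * w)%C).
    { replace c1 with (1 + 2 * w + z * (z * ((c1 - 1 - 2 * z * g z) / z ^ 2)))%C
        by (unfold w; field; assumption).
      rewrite Hjack. unfold w. ring. }
    assert (Hfz : f z = (z * (1 + w))%C) by (rewrite Hg; unfold w; ring).
    pose proof (second_order_C_derive _ _ _ _ _ Hso) as HDf.
    destruct (Ceq_dec (1 + w)%C 0) as [E | E].
    + rewrite E, Cmult_0_r in Hfz.
      pose proof (zero_derivative_at_zero f z Hfso Hre Hz ltac:(unfold unit_disc; lra) Hfz) as HD.
      rewrite HDf, Hc1 in HD.
      replace w with (1 + w - 1)%C in HD by ring. rewrite E in HD.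
      apply (f_equal Re) in HD. simpl in HD. lra.
    + specialize (Hre z ltac:(lra)). unfold zf'_over_f in Hre.
      destruct (Ceq_dec z 0) as [E' | _]; [easy |].
      rewrite HDf, Hc1, Hfz in Hre.
      replace (z * (1 + (2 + k) * w) / (z * (1 + w)))%C
        with ((1 + (2 + k) * w) / (1 + w))%C in Hre by (field; split; assumption).
      (* With [w = x + i y] on the unit circle, the cleared inequality is
         [(3 + k)(1 + x) < 3 (1 + x)], impossible since [k >= 0] and [x >= -1]. *)
      apply (Re_Cdiv_lt _ _ _ E) in Hre.
      assert (Hw2 := Cmod2_alt w). rewrite Hw1 in Hw2.
      clearbody w. destruct w as [x y]. simpl in Hre, Hw2.
      assert (Hx : -1 <= x) by nra.
      assert (Hkw := f_equal (Rmult k) Hw2).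
      assert (0 <= k * (1 + x)) by (apply Rmult_le_pos; lra).
      lra.
Qed.

(** Kept pointwise so that it serves both the general theorem and the lower bound in the infimum for
    [f0]. *)
Lemma f_over_z_bound_Re (f : C -> C) (z : C) :
  Cmod (f_over_z f z - 1)%C < 1 -> Re (z_over_f f z) > 1 / 2.
Proof.
  unfold f_over_z, z_over_f. destruct (Ceq_dec z 0) as [_ | Hz].
  - simpl; lra.
  - intros H.
    set (w := (f z / z)%C) in *.
    assert (Hw : w <> 0).
    { intros E. rewrite E in H. replace (0 - 1)%C with (- (1))%C in H by ring.
      rewrite Cmod_m1 in H. lra. }
    assert (Hf : f z <> 0).
    { intros E. apply Hw. unfold w. rewrite E. field. assumption. }
    replace (z / f z)%C with (/ w)%C by (unfold w; field; split; assumption).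
    assert (Hw2 : Cmod (w - 1)%C ^ 2 < 1).
    { pose proof (Cmod_ge_0 (w - 1)%C). simpl. nra. }
    assert (Hp : 0 < Cmod w ^ 2) by (apply pow_lt; now apply Cmod_gt_0).
    rewrite Cmod2_alt in Hw2, Hp. destruct w as [x y]. simpl in *.
    apply Rlt_gt. apply (Rmult_lt_reg_r (x * (x * 1) + y * (y * 1))); [easy |].
    unfold Rdiv. rewrite (Rmult_assoc x), Rinv_l; nra.
Qed.

(** * The extremal function and sharpness *)

Lemma f0_second_order (z : C) : second_order f0 z (z + z ^ 2)%C (1 + 2 * z)%C 1%C.
Proof.
  exists 0, 1. split; [lra |]. split; [lra |]. intros h _.
  unfold f0.
  match goal with |- Cmod ?u <= _ => replace u with (RtoC 0) by ring end.
  rewrite Cmod_0. lra.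
Qed.

Lemma f0_analytic : analytic_in_disc f0.
Proof.
  intros z _.
  exists (fun n : nat => match n with
                   | 0%nat => (z + z ^ 2)%C | 1%nat => (1 + 2 * z)%C
                   | 2%nat => RtoC 1 | _ => RtoC 0 end), 1.
  split; [lra |]. intros y _.
  unfold is_pseries, is_series.
  (* The coefficients are those of the Taylor polynomial of [f0] at [z], so the partial sums are
     constant from index 2 on. *)
  eapply filterlim_ext_loc; [| apply filterlim_const].
  exists 2%nat. intros n Hn.
  induction Hn as [| n Hn IH].
  - rewrite 2!sum_Sn, sum_O, !pow_n_Cpow.
    change (f0 y = (y - z) ^ 0 * (z + z ^ 2) + (y - z) ^ 1 * (1 + 2 * z) + (y - z) ^ 2 * 1)%C.
    unfold f0. ring.
  - rewrite sum_Sn, <- IH. destruct n as [|[|n]]; [lia | lia |].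
    rewrite pow_n_Cpow.
    change (f0 y = f0 y + (y - z) ^ S (S (S n)) * 0)%C. ring.
Qed.

Lemma f0_one_plus_neq_0 (z : C) : unit_disc z -> (1 + z)%C <> 0.
Proof.
  intros Hz E. unfold unit_disc in Hz.
  replace z with (- (1))%C in Hz.
  - rewrite Cmod_m1 in Hz. lra.
  - replace z with (1 + z - 1)%C by ring. rewrite E. ring.
Qed.

(** For [z <> 0] the quotient is [(1 + 2 z) / (1 + z)]; after multiplication by [|1 + z|^2] the
    bound [3/2] becomes exactly [|z|^2 < 1]. *)
Lemma f0_zf'_over_f (z : C) : unit_disc z -> Re (zf'_over_f f0 z) < 3 / 2.
Proof.
  intros Hz. pose proof (f0_one_plus_neq_0 z Hz) as H1.
  unfold zf'_over_f. destruct (Ceq_dec z 0) as [_ | E]; [simpl; lra |].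
  rewrite (second_order_C_derive _ _ _ _ _ (f0_second_order z)).
  unfold f0.
  replace (z + z ^ 2)%C with (z * (1 + z))%C by ring.
  replace (z * (1 + 2 * z) / (z * (1 + z)))%C with ((1 + 2 * z) / (1 + z))%C
    by (field; split; assumption).
  assert (Hz2 : Cmod z ^ 2 < 1).
  { unfold unit_disc in Hz. pose proof (Cmod_ge_0 z). simpl. nra. }
  assert (Hp : 0 < Cmod (1 + z)%C ^ 2) by (apply pow_lt; now apply Cmod_gt_0).
  rewrite Cmod2_alt in Hz2, Hp. destruct z as [x y]. simpl in *.
  match goal with |- ?u < _ => replace u with
    (((1 + 2 * x) * (1 + x) + 2 * y * y) / ((1 + x) * ((1 + x) * 1) + (0 + y) * ((0 + y) * 1)))
    by (field; nra) end.
  apply (Rmult_lt_reg_r ((1 + x) * ((1 + x) * 1) + (0 + y) * ((0 + y) * 1))); [easy |].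
  unfold Rdiv at 1. rewrite Rmult_assoc, Rinv_l; nra.
Qed.

Lemma f0_f_over_z (z : C) : Cmod (f_over_z f0 z - 1)%C = Cmod z.
Proof.
  unfold f_over_z, f0. destruct (Ceq_dec z 0) as [-> | E]; f_equal.
  - ring.
  - field. assumption.
Qed.

Theorem theorem2p2 :
  (forall f : C -> C,
     class_A f ->
     (forall z : C, unit_disc z -> Re (zf'_over_f f z) < 3 / 2) ->
     (forall z : C, unit_disc z -> Re (z_over_f f z) > 1 / 2) /\
     (forall z : C, unit_disc z -> Cmod (f_over_z f z - 1)%C < 1)) /\
  (class_A f0 /\
   (forall z : C, unit_disc z -> Re (zf'_over_f f0 z) < 3 / 2) /\
   is_glb_Rbar
     (fun x : R => exists z : C, unit_disc z /\ x = Re (z_over_f f0 z))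
     (Finite (1 / 2)) /\
   is_lub_Rbar
     (fun x : R => exists z : C, unit_disc z /\ x = Cmod (f_over_z f0 z - 1)%C)
     (Finite 1)).
Proof.
  assert (Hreal : forall t, 0 < t < 1 -> unit_disc t).
  { intros t Ht. unfold unit_disc. rewrite Cmod_R, Rabs_pos_eq; lra. }
  split; [| split; [| split; [| split]]].
  - intros f Hf Hre. split; intros z Hz.
    + apply f_over_z_bound_Re. now apply f_over_z_bound.
    + now apply f_over_z_bound.
  - split; [apply f0_analytic |]. split; [unfold f0; ring |].
    rewrite (second_order_C_derive _ _ _ _ _ (f0_second_order 0)). ring.
  - exact f0_zf'_over_f.
  - assert (Hval : forall t, 0 < t < 1 -> Re (z_over_f f0 t) = / (1 + t)).
    { intros t Ht. unfold z_over_f.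
      pose proof (f0_one_plus_neq_0 t (Hreal t Ht)) as H1.
      destruct (Ceq_dec t 0) as [E | E].
      { apply (f_equal Re) in E. simpl in E. lra. }
      replace (f0 t) with (t * (1 + t))%C by (unfold f0; ring).
      replace (t / (t * (1 + t)))%C with (/ (1 + t))%C by (field; split; assumption).
      rewrite <- RtoC_plus, <- RtoC_inv by lra. reflexivity. }
    split.
    + intros x [z [Hz ->]]. simpl. left. apply Rgt_lt, f_over_z_bound_Re.
      rewrite f0_f_over_z. exact Hz.
    + intros [r | |] Hb; [| | exact I].
      * simpl. apply Rnot_lt_le; intros Hr.
        (* For a supposed lower bound [r > 1/2] this gives [r (1 + t) = r + 1/2 > 1], so the value
           [1 / (1 + t)] lies below [r]. *)
        set (t := / (2 * r)).
        assert (Et : t * (2 * r) = 1) by (unfold t; field; lra).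
        assert (Ht : 0 < t < 1).
        { split; [apply Rinv_0_lt_compat; lra | nra]. }
        specialize (Hb _ (ex_intro _ (RtoC t) (conj (Hreal t Ht) eq_refl))).
        simpl in Hb. rewrite Hval in Hb by easy.
        assert (r * (1 + t) <= 1).
        { replace 1 with (/ (1 + t) * (1 + t)) at 2 by (field; lra).
          apply Rmult_le_compat_r; lra. }
        lra.
      * exact (Hb _ (ex_intro _ (RtoC (1 / 2)) (conj (Hreal (1 / 2) ltac:(lra)) eq_refl))).
  - split.
    + intros x [z [Hz ->]]. simpl. left. rewrite f0_f_over_z. exact Hz.
    + intros [r | |] Hb; [| exact I |].
      * simpl. apply Rnot_lt_le; intros Hr.
        (* The midpoint between the supposed upper bound and 1; the maximum with 0 keeps [t]
           positive when [r] is negative. *)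
        set (t := (1 + Rmax r 0) / 2).
        pose proof (Rmax_l r 0). pose proof (Rmax_r r 0).
        assert (Rmax r 0 < 1) by (apply Rmax_lub_lt; lra).
        assert (Ht : 0 < t < 1) by (unfold t; lra).
        specialize (Hb _ (ex_intro _ (RtoC t) (conj (Hreal t Ht) eq_refl))).
        simpl in Hb. rewrite f0_f_over_z, Cmod_R, Rabs_pos_eq in Hb by lra.
        unfold t in Hb. lra.
      * exact (Hb _ (ex_intro _ (RtoC (1 / 2)) (conj (Hreal (1 / 2) ltac:(lra)) eq_refl))).
Qed.
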